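(* Let $M$ be a smooth manifold with Riemannian metric $g$, let $X$ be a smooth vector field on $M$, and let $\tilde{\mathcal{U}}\subseteq M$ be a compact set. If the symmetric $(0,2)$-tensor $\mathcal{L}_X g$ is negative definite on $\tilde{\mathcal{U}}$ (i.e. $(\mathcal{L}_X g)(v_x,v_x)<0$ for all $x\in\tilde{\mathcal{U}}$ and all nonzero $v_x\in T_xM$), then for any open subset $\mathcal{U}$ of $M$ with $\mathcal{U}\subseteq\tilde{\mathcal{U}}$, the tuple $(M,X,g,\mathcal{U})$ is a contracting system.
   Context: The Lie derivative of the tensor $g$ along $X$ is the $(0,2)$-tensor $(\mathcal{L}_X g)(Y,Z)=X(g(Y,Z))-g([X,Y],Z)-g(Y,[X,Z])$. A contracting system is a tuple $(M,X,g,\mathcal{U})$, where $M$ is a smooth manifold, $X$ is a smooth vector field on $M$, $g$ is a Riemannian metric on $M$ (the contraction metric) and $\mathcal{U}$ is an open subset of $M$, such that there exists $\lambda>0$ (the contraction rate) for which $(\mathcal{L}_X g)(v_x,v_x)\leq -2\lambda\, g(v_x,v_x)$ for all $x\in\mathcal{U}$ and all $v_x\in T_xM$. *)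

(* Defs.v *)
From HB Require Import structures.
From mathcomp Require Import all_boot all_order all_algebra.
From mathcomp Require Import all_classical all_reals all_analysis.

Set Implicit Arguments.
Unset Strict Implicit.
Unset Printing Implicit Defensive.

Import Order.TTheory GRing.Theory Num.Theory.
Import numFieldNormedType.Exports.

Local Open Scope classical_set_scope.
Local Open Scope ring_scope.

(* [U] is meant to be open: differentiability and continuity are taken at the
   points of [U] with respect to the whole space. *)
Fixpoint Ck_on (R : realType) (V W : normedModType R) (k : nat) (U : set V)
    (f : V -> W) : Prop :=
  if k is k'.+1 then
    (forall x, U x -> differentiable f x) /\
    (forall v : V, Ck_on k' U (fun x => 'D_v f x))
  else forall x, U x -> {for x, continuous f}.

Definition smooth_on (R : realType) (V W : normedModType R) (U : set V)
    (f : V -> W) : Prop :=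
  forall k, Ck_on k U f.

(* A homeomorphism from an open subset of [T] onto an open subset of R^n.
   [cmap] and [cinv] are total functions, meaningful only on [cdom] and on
   [cmap @` cdom] respectively. *)
Record chart (R : realType) (n : nat) (T : topologicalType) := Chart {
  cdom : set T ;
  cmap : T -> 'rV[R]_n ;
  cinv : 'rV[R]_n -> T ;
  cdom_open : open cdom ;
  cimg_open : open (cmap @` cdom) ;
  cmapK : forall x, cdom x -> cinv (cmap x) = x ;
  cmap_continuous : {within cdom, continuous cmap} ;
  cinv_continuous : {within cmap @` cdom, continuous cinv} }.

Record smoothManifold (R : realType) (n : nat) := SmoothManifold {
  msort :> topologicalType ;
  manifold_hausdorff : hausdorff_space msort ;
  manifold_second_countable : @second_countable msort ;
  atlas : set (chart R n msort) ;
  atlas_cover : forall x : msort, exists2 c, atlas c & cdom c x ;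
  atlas_compatible : forall c c', atlas c -> atlas c' ->
    smooth_on (cmap c @` (cdom c `&` cdom c')) (cmap c' \o cinv c) }.

Definition chart_at (R : realType) (n : nat) (M : smoothManifold R n) (x : M) :
    chart R n M :=
  projT1 (cid2 (atlas_cover x)).

(* T_xM is represented by R^n: a tangent vector at [x] is given by its
   coordinates in the chart [chart_at x].  Coordinates in other charts are
   obtained through [coord_change]. *)
Definition tangent (R : realType) (n : nat) (M : smoothManifold R n) (x : M) :
    normedModType R :=
  'rV[R]_n.

(* The differential at [cmap c x] of the transition map from [c] to [c']. *)
Definition coord_change (R : realType) (n : nat) (M : smoothManifold R n)
    (c c' : chart R n M) (x : M) (v : 'rV[R]_n) : 'rV[R]_n :=
  'D_v (cmap c' \o cinv c) (cmap c x).

Definition tangent_of_coord (R : realType) (n : nat) (M : smoothManifold R n)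
    (c : chart R n M) (x : M) (v : 'rV[R]_n) : tangent x :=
  coord_change c (chart_at x) x v.

Definition coord_of_tangent (R : realType) (n : nat) (M : smoothManifold R n)
    (c : chart R n M) (x : M) (v : tangent x) : 'rV[R]_n :=
  coord_change (chart_at x) c x v.

(* The components of the vector field [X] in the chart [c], as functions of
   the coordinates. *)
Definition field_in_chart (R : realType) (n : nat) (M : smoothManifold R n)
    (c : chart R n M) (X : forall x : M, tangent x) (u : 'rV[R]_n) : 'rV[R]_n :=
  coord_of_tangent c (X (cinv c u)).

Definition smooth_field_on (R : realType) (n : nat) (M : smoothManifold R n)
    (W : set M) (X : forall x : M, tangent x) : Prop :=
  forall c, atlas c ->
    smooth_on (cmap c @` (cdom c `&` W)) (field_in_chart c X).

Definition smooth_field (R : realType) (n : nat) (M : smoothManifold R n)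
    (X : forall x : M, tangent x) : Prop :=
  smooth_field_on setT X.

Definition riemannian_metric (R : realType) (n : nat) (M : smoothManifold R n)
    (g : forall x : M, tangent x -> tangent x -> R) : Prop :=
  [/\ forall x (v : tangent x), scalar (g x v),
      forall x (v w : tangent x), g x v w = g x w v,
      forall x (v : tangent x), v != 0 -> 0 < g x v v
    & forall c, atlas c -> forall v w : 'rV[R]_n,
        smooth_on (cmap c @` cdom c) (fun u =>
          g (cinv c u) (tangent_of_coord c (cinv c u) v)
                       (tangent_of_coord c (cinv c u) w))].

(* v(f), the derivative of the function [f] along the tangent vector [v]. *)
Definition tangent_apply (R : realType) (n : nat) (M : smoothManifold R n)
    (x : M) (v : tangent x) (f : M -> R) : R :=
  'D_v (f \o cinv (chart_at x)) (cmap (chart_at x) x).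

(* The Lie bracket [X,Y], with the sign convention
   [X,Y]f = X(Yf) - Y(Xf), computed at each point in the chart at that point. *)
Definition lie_bracket (R : realType) (n : nat) (M : smoothManifold R n)
    (X Y : forall x : M, tangent x) (x : M) : tangent x :=
  let c := chart_at x in
  'D_(X x) (field_in_chart c Y) (cmap c x)
  - 'D_(Y x) (field_in_chart c X) (cmap c x).

(* (L_X g)(Y,Z), for vector fields [Y] and [Z], as a function on [M]. *)
Definition lie_derivative_fields (R : realType) (n : nat)
    (M : smoothManifold R n) (X : forall x : M, tangent x)
    (g : forall x : M, tangent x -> tangent x -> R)
    (Y Z : forall x : M, tangent x) (x : M) : R :=
  tangent_apply (X x) (fun y => g y (Y y) (Z y))
  - g x (lie_bracket X Y x) (Z x)
  - g x (Y x) (lie_bracket X Z x).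

(* (L_X g)(v,w) for tangent vectors at [x]: the value of (L_X g)(Y,Z) at [x]
   for any vector fields [Y], [Z], smooth near [x], extending [v] and [w].
   As L_X g is a tensor, this value does not depend on the extensions; they
   always exist (take constant components in a chart), so that the default
   value [0] is never used when [X] and [g] are smooth. *)
Definition lie_derivative (R : realType) (n : nat) (M : smoothManifold R n)
    (X : forall x : M, tangent x)
    (g : forall x : M, tangent x -> tangent x -> R)
    (x : M) (v w : tangent x) : R :=
  xget 0 [set r | forall (W : set M) (Y Z : forall y : M, tangent y),
    open W -> W x -> smooth_field_on W Y -> smooth_field_on W Z ->
    Y x = v -> Z x = w -> lie_derivative_fields X g Y Z x = r].

Definition negative_definite_on (R : realType) (n : nat)
    (M : smoothManifold R n) (h : forall x : M, tangent x -> tangent x -> R)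
    (A : set M) : Prop :=
  forall x, A x -> forall v : tangent x, v != 0 -> h x v v < 0.

Definition contracting_system (R : realType) (n : nat)
    (M : smoothManifold R n) (X : forall x : M, tangent x)
    (g : forall x : M, tangent x -> tangent x -> R) (U : set M) : Prop :=
  [/\ smooth_field X, riemannian_metric g, open U
    & exists lambda : R, 0 < lambda /\
        forall x, U x -> forall v : tangent x,
          lie_derivative X g v v <= - (2 * lambda) * g x v v].

(* Main.v *)
Require Import Defs.
From HB Require Import structures.
From mathcomp Require Import all_boot all_order all_algebra.
From mathcomp Require Import all_classical all_reals all_analysis.
From mathcomp Require Import ring.

Set Implicit Arguments.
Unset Strict Implicit.
Unset Printing Implicit Defensive.

Import Order.TTheory GRing.Theory Num.Theory.
Import numFieldNormedType.Exports.

Local Open Scope classical_set_scope.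
Local Open Scope ring_scope.

(** Write [G(u)] and [F(u)] for the components of the metric [g] and of the field
    [X] in a chart [c].  In that chart the Lie derivative is the quadratic form

      L(u)(w, w) = (D_F(u) G)(w, w) + 2 G(u)(D_w F, w),

    whose coefficients are continuous in [u].  Around a point where it is
    negative definite, compactness of the unit sphere of R^n shows that
    [L(y)(w, w) + 2 s G(y)(w, w)] stays negative for unit [w], for all points
    [y] close enough and all reals [s] close enough to 0
    ([near_negative_form]); homogeneity extends this to all [w].  A compact set
    is covered by finitely many such neighbourhoods, so one neighbourhood of 0
    serves for [s] over the whole compact set, and any positive element of it
    is a contraction rate.

    This argument compares the Lie derivative at all points near a given one
    in a single chart, whereas tangent vectors, Lie brackets and the Lie
    derivative are read at each point [x] in the chart chosen at [x], and that
    choice varies with [x] without any regularity.  Most of the work therefore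
    shows that the formula above computes the Lie derivative in every chart of
    the atlas ([lie_derivative_in_chart]).  This has two halves.

    - In the chart at [x], the product rule makes the derivatives of the
      extensions [Y] and [Z] cancel between [X(g(Y, Z))] and the two brackets
      ([lie_derivative_fieldsE]); the value thus depends only on the vectors at
      [x].  Admissible extensions exist, namely the fields with constant
      components in a chart, which are smooth because transition maps are
      ([smooth_constant_field]), so the value that defines [lie_derivative] is
      really attained ([lie_derivativeE]).
    - Under a transition map [T], the terms of [L] change by second derivatives
      of [T], which cancel because they are symmetric
      ([lie_in_chart_change]).  The symmetry is Schwarz's theorem
      ([derive_commute]), obtained from the mean value theorem. *)

(** * Directional derivatives *)

Lemma derive_comp (R : realType) (U V W : normedModType R) (f : U -> V)
    (g : V -> W) x v : differentiable f x -> differentiable g (f x) ->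
  'D_v (g \o f) x = 'D_('D_v f x) g (f x).
Proof.
move=> df dg.
rewrite (deriveE _ (differentiable_comp df dg)) (diff_comp df dg) /=.
by rewrite (deriveE v df) (deriveE _ dg).
Qed.

Lemma derive_linear (R : realType) (V W : normedModType R) (f : V -> W) x :
  differentiable f x -> linear (fun v => 'D_v f x).
Proof. by move=> df a u v; rewrite !(deriveE _ df) linearP. Qed.

Lemma rV_basis_expand (R : realType) n (W : lmodType R) (h : 'rV[R]_n -> W) :
  linear h -> forall v, h v = \sum_(i < n) v 0 i *: h (delta_mx 0 i).
Proof.
move=> hl v; rewrite {1}(row_sum_delta v).
pose hL := GRing.isLinear.Build _ _ _ _ h hl.
pose H : {linear 'rV[R]_n -> W} := HB.pack h hL.
rewrite -[h]/(H : _ -> _) linear_sum; apply: eq_bigr => i _.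
by rewrite linearZ.
Qed.

(** The scaling [R -> W -> W] is a continuous bilinear map, so the differential
    of [a *: f] comes from that of a bilinear map and the chain rule. *)
Section DifferentiationOfScaling.
Context (R : realType) (V W : normedModType R).

Lemma scale_is_bilinear :
  bilinear_for
    (GRing.Scale.Law.clone _ _ *:%R _) (GRing.Scale.Law.clone _ _ *:%R _)
    (@GRing.scale R W).
Proof.
split=> [u'|u] a x y /=.
- by rewrite scalerDl scalerA.
- by rewrite scalerDr !scalerA mulrC.
Qed.
HB.instance Definition _ := bilinear_isBilinear.Build R R W W _ _
  (@GRing.scale R W) scale_is_bilinear.

Lemma is_diff_scale (a da : V -> R) (f df : V -> W) x :
  is_diff x a da -> is_diff x f df ->
  is_diff x (fun y => a y *: f y) (fun v => a x *: df v + da v *: f x).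
Proof.
move=> dax dfx.
have dS (p : R * W) :
    is_diff p (fun q => q.1 *: q.2) (fun q => p.1 *: q.2 + q.1 *: p.2).
  have sc : continuous (fun q : R * W => q.1 *: q.2).
    by move=> q; apply: scale_continuous.
  apply: DiffDef; first exact: (@differentiable_bilin _ _ _ _ (@GRing.scale R W)).
  exact: (@diff_bilin _ _ _ _ (@GRing.scale R W)).
have -> : (fun y => a y *: f y) = (fun p => p.1 *: p.2) \o (fun y => (a y, f y)).
  by [].
exact: is_diff_eq.
Qed.

Lemma differentiable_scale (a : V -> R) (f : V -> W) x :
  differentiable a x -> differentiable f x ->
  differentiable (fun y => a y *: f y) x.
Proof.
move=> /differentiableP da /differentiableP df.
by have := is_diff_scale da df => -[].
Qed.

Lemma derive_scale (a : V -> R) (f : V -> W) x v :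
  differentiable a x -> differentiable f x ->
  'D_v (fun y => a y *: f y) x = a x *: 'D_v f x + 'D_v a x *: f x.
Proof.
move=> da df.
rewrite (deriveE v (differentiable_scale da df)) (deriveE v da) (deriveE v df).
by have [_ ->] := is_diff_scale (differentiableP da) (differentiableP df).
Qed.

End DifferentiationOfScaling.

Lemma differentiable_sumf (R : realType) (V W : normedModType R) n
    (f : 'I_n -> V -> W) x : (forall i, differentiable (f i) x) ->
  differentiable (fun y => \sum_(i < n) f i y) x.
Proof.
move=> df.
have -> : (fun y => \sum_(i < n) f i y) = \sum_(i < n) f i.
  by apply/funext => y; rewrite fct_sumE.
exact: differentiable_sum.
Qed.

Lemma derive_sumf (R : realType) (V W : normedModType R) n
    (f : 'I_n -> V -> W) x v : (forall i, differentiable (f i) x) ->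
  'D_v (fun y => \sum_(i < n) f i y) x = \sum_(i < n) 'D_v (f i) x.
Proof.
move=> df.
have -> : (fun y => \sum_(i < n) f i y) = \sum_(i < n) f i.
  by apply/funext => y; rewrite fct_sumE.
by rewrite derive_sum// => i; apply: diff_derivable.
Qed.

Lemma differentiable_coordf (R : realType) (V : normedModType R) n
    (f : V -> 'rV[R]_n) x i :
  differentiable f x -> differentiable (fun y => f y 0 i) x.
Proof.
move=> df; apply: (@differentiable_comp _ _ _ _ f (fun N : 'rV[R]_n => N 0 i)) => //.
exact: differentiable_coord.
Qed.

Lemma derive_coordf (R : realType) (V : normedModType R) n
    (f : V -> 'rV[R]_n) x v i :
  differentiable f x -> 'D_v (fun y => f y 0 i) x = ('D_v f x) 0 i.
Proof.
by move=> df; rewrite derive_mx ?mxE//; apply: diff_derivable.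
Qed.

(** The differential of [f] also satisfies the first order expansion that
    characterises the differential of [g], because only values near [x] enter. *)
Lemma near_eq_differentiable (R : realType) (V W : normedModType R)
    (f g : V -> W) x :
  (\near x, f x = g x) -> differentiable f x -> differentiable g x.
Proof.
move=> fg /diff_locallyP[cdf /eqaddoP fE].
have fg0 : \forall h \near (0 : V), f (h + x) = g (h + x).
  by move: (fg); rewrite (near_shift 0) /= subr0.
have gE : g \o shift x = cst (g x) + 'd f x +o_ (0 : V) id.
  apply/eqaddoP => e e0; near=> h.
  have -> : (g \o shift x - (cst (g x) + 'd f x)) h =
            (f \o shift x - (cst (f x) + 'd f x)) h.
    rewrite -[LHS]/(g (h + x) - (g x + 'd f x h)).
    rewrite -[RHS]/(f (h + x) - (f x + 'd f x h)).
    by rewrite -(nbhs_singleton fg); congr (_ - _); near: h; near do apply/esym.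
  by near: h; exact: fE.
have dgE := diff_unique cdf gE.
by apply/diff_locallyP; rewrite dgE; split.
Unshelve. all: by end_near. Qed.

(** * Calculus of smooth functions *)

Section Ck.
Context (R : realType).
Implicit Types V W : normedModType R.

Lemma Ck_on_sub V W k (U U' : set V) (f : V -> W) :
  U `<=` U' -> Ck_on k U' f -> Ck_on k U f.
Proof.
move=> UU'; elim: k f => [|k IHk] f /=; first by move=> + x /UU'; exact.
by move=> [df Df]; split=> [x /UU' /df //|v]; exact: IHk.
Qed.

(** Openness of [U] is what makes equality on [U] an equality near each of its
    points, hence inherited by directional derivatives. *)
Lemma Ck_on_eq V W k (U : set V) (f g : V -> W) : open U ->
  (forall x, U x -> f x = g x) -> Ck_on k U f -> Ck_on k U g.
Proof.
move=> oU; have nearU h1 h2 x : (forall y, U y -> h1 y = h2 y :> W) -> U x ->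
    \near x, h1 x = h2 x.
  by move=> h12 Ux; near=> y; apply: h12; near: y; exact: open_nbhs_nbhs.
elim: k f g => [|k IHk] f g fg /=.
  move=> cf x Ux; rewrite /prop_for /= /continuous_at -(fg _ Ux).
  by apply: cvg_trans (cf x Ux); apply: near_eq_cvg; exact: nearU.
move=> [df Df]; split=> [x Ux|v].
  by apply: near_eq_differentiable (df x Ux); exact: nearU.
by apply: IHk (Df v) => x Ux; apply: near_eq_derive; exact: nearU.
Unshelve. all: by end_near. Qed.

Lemma Ck_onS V W k (U : set V) (f : V -> W) : Ck_on k.+1 U f -> Ck_on k U f.
Proof.
elim: k f => [|k IHk] f; first by move=> [df _] x /df /differentiable_continuous.
by move=> [df Df]; split=> // v; apply: IHk; exact: Df.
Qed.

Lemma Ck_on_cst V W k (U : set V) (w : W) : Ck_on k U (fun=> w).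
Proof.
elim: k w => [|k IHk] w /=; first by move=> x _; exact: cst_continuous.
split=> [x _|v]; first exact: differentiable_cst.
have -> : (fun x : V => 'D_v (fun=> w) x) = fun=> 0.
  by apply/funext => x; exact: derive_cst.
exact: IHk.
Qed.

Lemma Ck_on_add V W k (U : set V) (f g : V -> W) : open U ->
  Ck_on k U f -> Ck_on k U g -> Ck_on k U (fun x => f x + g x).
Proof.
move=> oU; elim: k f g => [|k IHk] f g /=.
  by move=> cf cg x Ux; apply: cvgD; [exact: cf|exact: cg].
move=> [df Df] [dg Dg]; split=> [x Ux|v].
  by apply: differentiableD; [exact: df|exact: dg].
apply: Ck_on_eq (IHk _ _ (Df v) (Dg v)) => // x Ux.
by rewrite deriveD//; apply: diff_derivable; [exact: df|exact: dg].
Qed.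

Lemma Ck_on_sum V W k (U : set V) n (f : 'I_n -> V -> W) : open U ->
  (forall i, Ck_on k U (f i)) -> Ck_on k U (fun x => \sum_(i < n) f i x).
Proof.
move=> oU; elim: n f => [|n IHn] f Cf.
  under [X in Ck_on _ _ X]funext do rewrite big_ord0.
  exact: Ck_on_cst.
under [X in Ck_on _ _ X]funext do rewrite big_ord_recl.
by apply: Ck_on_add => //; exact: IHn.
Qed.

Lemma Ck_on_scale V W k (U : set V) (a : V -> R) (f : V -> W) : open U ->
  Ck_on k U a -> Ck_on k U f -> Ck_on k U (fun x => a x *: f x).
Proof.
move=> oU; elim: k a f => [|k IHk] a f.
  by move=> ca cf x Ux; apply: cvgZ; [exact: ca|exact: cf].
move=> Ca Cf; have [da Da] := Ca; have [df Df] := Cf; split=> [x Ux|v].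
  by apply: differentiable_scale; [exact: da|exact: df].
have Ck : Ck_on k U (fun x => a x *: 'D_v f x + 'D_v a x *: f x).
  apply: Ck_on_add => //; apply: IHk.
  - exact: Ck_onS Ca.
  - exact: Df.
  - exact: Da.
  - exact: Ck_onS Cf.
apply: Ck_on_eq Ck => // x Ux.
by rewrite derive_scale//; [exact: da|exact: df].
Qed.

Lemma Ck_on_coord V k (U : set V) n (f : V -> 'rV[R]_n) i : open U ->
  Ck_on k U f -> Ck_on k U (fun x => f x 0 i).
Proof.
move=> oU; elim: k f => [|k IHk] f /=.
  move=> cf x Ux; apply: (@continuous_comp _ _ _ f (fun N : 'rV[R]_n => N 0 i)).
    exact: cf.
  exact: coord_continuous.
move=> [df Df]; split=> [x Ux|v].
  by apply: differentiable_coordf; exact: df.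
apply: Ck_on_eq (IHk _ (Df v)) => // x Ux.
by rewrite derive_coordf//; exact: df.
Qed.

(** By the chain rule, [D_v (f \o g)] is a combination of the functions
    [D_(e_i) f \o g] with coefficients the coordinates of [D_v g]; the induction
    on [k] applies to them only because the directions [e_i] are fixed, which is
    why [D_v g] is expanded on the basis. *)
Lemma Ck_on_comp V W k n (U : set V) (U' : set 'rV[R]_n)
    (g : V -> 'rV[R]_n) (f : 'rV[R]_n -> W) : open U ->
  (forall x, U x -> U' (g x)) -> Ck_on k U g -> Ck_on k U' f ->
  Ck_on k U (f \o g).
Proof.
move=> oU gU; elim: k f => [|k IHk] f Cg Cf.
  by move=> x Ux; apply: continuous_comp; [exact: Cg|exact/Cf/gU].
have [dg Dg] := Cg; have [df Df] := Cf; split=> [x Ux|v].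
  by apply: differentiable_comp; [exact: dg|exact/df/gU].
have CD : Ck_on k U (fun x => \sum_(i < n)
    ('D_v g x) 0 i *: ('D_(delta_mx 0 i) f \o g) x).
  apply: Ck_on_sum => // i; apply: Ck_on_scale => //.
    by apply: Ck_on_coord => //; exact: Dg.
  by apply: IHk => //; [exact: Ck_onS Cg|exact: Df].
apply: Ck_on_eq CD => // x Ux.
rewrite (derive_comp v (dg x Ux) (df _ (gU _ Ux))).
by rewrite (rV_basis_expand (derive_linear (df _ (gU _ Ux)))).
Qed.

End Ck.

Section Smooth.
Context (R : realType).
Implicit Types V W : normedModType R.

Lemma smooth_on_sub V W (U U' : set V) (f : V -> W) :
  U `<=` U' -> smooth_on U' f -> smooth_on U f.
Proof. by move=> UU' sf k; exact: Ck_on_sub (sf k). Qed.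

Lemma smooth_on_eq V W (U : set V) (f g : V -> W) : open U ->
  (forall x, U x -> f x = g x) -> smooth_on U f -> smooth_on U g.
Proof. by move=> oU fg sf k; exact: Ck_on_eq (sf k). Qed.

Lemma smooth_on_comp V W n (U : set V) (U' : set 'rV[R]_n)
    (g : V -> 'rV[R]_n) (f : 'rV[R]_n -> W) : open U ->
  (forall x, U x -> U' (g x)) -> smooth_on U g -> smooth_on U' f ->
  smooth_on U (f \o g).
Proof. by move=> oU gU sg sf k; exact: Ck_on_comp (sg k) (sf k). Qed.

Lemma smooth_on_coord V (U : set V) n (f : V -> 'rV[R]_n) i : open U ->
  smooth_on U f -> smooth_on U (fun x => f x 0 i).
Proof. by move=> oU sf k; exact: Ck_on_coord. Qed.

Lemma smooth_on_derive V W (U : set V) (f : V -> W) v :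
  smooth_on U f -> smooth_on U (fun x => 'D_v f x).
Proof. by move=> sf k; have [_] := sf k.+1; exact. Qed.

Lemma smooth_on_differentiable V W (U : set V) (f : V -> W) x :
  smooth_on U f -> U x -> differentiable f x.
Proof. by move=> /(_ 1%N)[+ _]; exact. Qed.

Lemma smooth_on_continuous V W (U : set V) (f : V -> W) x :
  smooth_on U f -> U x -> {for x, continuous f}.
Proof. by move=> /(_ 0%N); exact. Qed.

End Smooth.

(** * Symmetry of second derivatives *)

Section Schwarz.
Context (R : realType) (V : normedModType R).

Lemma is_derive_line (W : normedModType R) (f : V -> W) x v (s : R) :
  differentiable f (x + s *: v) ->
  is_derive s 1 (fun r : R => f (x + r *: v)) ('D_v f (x + s *: v)).
Proof.
move=> df; have dl : is_diff s (fun r : R => x + r *: v) (0 + *:%R^~ v).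
  exact: is_diffD.
have dls : differentiable (fun r : R => x + r *: v) s by case: dl.
apply: DeriveDef; first exact/diff_derivable/(differentiable_comp dls).
rewrite -[LHS]/('D_1 (f \o (fun r : R => x + r *: v)) s) derive_comp//.
by rewrite (deriveE _ dls); case: dl => _ ->; rewrite /= add0r scale1r.
Qed.

Lemma derive_translate (W : normedModType R) (f : V -> W) c v x :
  'D_v (fun y => f (y + c)) x = 'D_v f (x + c).
Proof. by rewrite /derive /=; under eq_fun do rewrite -addrA. Qed.

Lemma differentiable_translate (W : normedModType R) (f : V -> W) c x :
  differentiable f (x + c) -> differentiable (fun y => f (y + c)) x.
Proof.
by move=> df; apply: (@differentiable_comp _ _ _ _ (fun y => y + c) f).
Qed.

Lemma mean_value_line (f : V -> R) x v (t : R) : 0 <= t ->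
  (forall s, 0 <= s <= t -> differentiable f (x + s *: v)) ->
  exists2 s, 0 <= s <= t & f (x + t *: v) - f x = t * 'D_v f (x + s *: v).
Proof.
move=> t0 df.
have dl s : s \in `[0, t]%R -> is_derive s 1 (fun r => f (x + r *: v))
    ('D_v f (x + s *: v)).
  by rewrite in_itv/= => st; exact/is_derive_line/df.
have dlo s : s \in `]0, t[%R -> is_derive s 1 (fun r => f (x + r *: v))
    ('D_v f (x + s *: v)).
  by move=> st; apply: dl; exact: subset_itv_oo_cc.
have cl : {within `[0, t], continuous (fun r => f (x + r *: v))}.
  by apply: derivable_within_continuous => s st; case: (dl _ st).
have [s] := MVT_segment t0 dlo cl.
rewrite in_itv/= scale0r addr0 subr0 => st ->.
by exists s => //; rewrite mulrC.
Qed.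

(** The second difference of [f] along a parallelogram is a mixed second
    derivative at some point of it; as the second difference is symmetric in
    the two sides, this compares the two mixed derivatives. *)
Lemma second_difference (U : set V) (f : V -> R) x v w (t : R) : 0 <= t ->
  Ck_on 2 U f ->
  (forall a b, 0 <= a <= t -> 0 <= b <= t -> U (x + a *: v + b *: w)) ->
  exists a b, [/\ 0 <= a <= t, 0 <= b <= t &
    f (x + t *: v + t *: w) - f (x + t *: v) - (f (x + t *: w) - f x) =
    t * (t * 'D_w (fun y => 'D_v f y) (x + a *: v + b *: w))].
Proof.
move=> t0 [df Df] Uab; have t0t : 0 <= t <= t by rewrite t0 lexx.
have Ua a : 0 <= a <= t -> U (x + a *: v).
  by move=> at_; rewrite -[_ + _]addr0 -(scale0r w); apply: Uab => //; rewrite lexx.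
have dfw a : 0 <= a <= t -> differentiable (fun y => f (y + t *: w)) (x + a *: v).
  by move=> at_; apply/differentiable_translate/df/Uab.
have dfa a : 0 <= a <= t -> differentiable f (x + a *: v).
  by move=> at_; apply/df/Ua.
have [a at_ Ea] := @mean_value_line (fun y => f (y + t *: w) - f y) x v t t0
  (fun a at_ => differentiableB (dfw a at_) (dfa a at_)).
have [b bt Eb] := @mean_value_line (fun y => 'D_v f y) (x + a *: v) w t t0
  (fun b bt => (Df v).1 _ (Uab a b at_ bt)).
exists a, b; split => //; rewrite -Eb.
have -> : f (x + t *: v + t *: w) - f (x + t *: v) - (f (x + t *: w) - f x) =
  t * 'D_v (fun y => f (y + t *: w) - f y) (x + a *: v) by rewrite -Ea.
congr (_ * _); rewrite deriveB; last 2 first.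
- exact/diff_derivable/dfw.
- exact/diff_derivable/dfa.
by rewrite derive_translate.
Qed.

(** If the two values differed, disjoint neighbourhoods of them would pull back to
    a neighbourhood of [x] in which no values of [h1] and [h2] agree. *)
Lemma eq_of_nearby_values (T : topologicalType) (h1 h2 : T -> R) x :
  {for x, continuous h1} -> {for x, continuous h2} ->
  (forall A, nbhs x A -> exists p q, [/\ A p, A q & h1 p = h2 q]) ->
  h1 x = h2 x.
Proof.
move=> c1 c2 h12; apply: norm_hausdorff => A B /c1 nA /c2 nB.
have [p [q [[Ap _] [_ Bq] pq]]] := h12 _ (@filterI _ (nbhs x) _ _ _ nA nB).
by exists (h1 p); split => //; rewrite pq.
Qed.

(** On small squares spanned by [v] and [w], the second difference of [f] is, up
    to the square of the side, both a value of [D_w D_v f] and a value of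
    [D_v D_w f] near [x]. *)
Theorem derive_commute (U : set V) (f : V -> R) x v w : open U -> Ck_on 2 U f ->
  U x -> 'D_w (fun y => 'D_v f y) x = 'D_v (fun y => 'D_w f y) x.
Proof.
move=> oU Cf Ux; apply: (@eq_of_nearby_values _ (fun y => 'D_w (fun y => 'D_v f y) y)
  (fun y => 'D_v (fun y => 'D_w f y) y)).
- exact: ((Cf.2 v).2 w x Ux).
- exact: ((Cf.2 w).2 v x Ux).
move=> A nA; have /nbhs_ballP[r /= r0 xr] : nbhs x (A `&` U).
  by apply: filterI => //; exact: open_nbhs_nbhs.
(* The side [t] keeps the whole square inside the ball of radius [r]. *)
pose t := r / (`|v| + `|w| + 1).
have d0 : 0 < `|v| + `|w| + 1 by rewrite ltr_wpDl// addr_ge0.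
have t0 : 0 < t by rewrite divr_gt0.
have inr u1 u2 a b : `|u1| + `|u2| = `|v| + `|w| -> 0 <= a <= t -> 0 <= b <= t ->
    (A `&` U) (x + a *: u1 + b *: u2).
  move=> u12 /andP[a0 at_] /andP[b0 bt]; apply: xr; rewrite -ball_normE /ball_ /=.
  rewrite -addrA opprD addNKr normrN (le_lt_trans (ler_normD _ _))// !normrZ.
  rewrite (ger0_norm a0) (ger0_norm b0).
  rewrite (@le_lt_trans _ _ (t * (`|v| + `|w|)))//.
    by rewrite -u12 mulrDr lerD// ler_wpM2r.
  by rewrite /t mulrAC ltr_pdivrMr// ltr_pM2l// ltrDl.
have wv : `|w| + `|v| = `|v| + `|w| by rewrite addrC.
have [a [b [at_ bt Eab]]] := @second_difference U f x v w t (ltW t0) Cf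
  (fun a b ha hb => (inr v w a b erefl ha hb).2).
have [b' [a' [bt' at' Eba]]] := @second_difference U f x w v t (ltW t0) Cf
  (fun a b ha hb => (inr w v a b wv ha hb).2).
exists (x + a *: v + b *: w), (x + b' *: w + a' *: v); split.
- exact: (inr v w a b erefl at_ bt).1.
- exact: (inr w v b' a' wv bt' at').1.
apply: (mulfI (lt0r_neq0 t0)); apply: (mulfI (lt0r_neq0 t0)).
apply: (etrans (esym Eab) (etrans _ Eba)); rewrite (addrAC x).
by rewrite !opprB [LHS]addrC [RHS]addrC; ring.
Qed.

End Schwarz.

Lemma derive_commute_rV (R : realType) (V : normedModType R) n (U : set V)
    (f : V -> 'rV[R]_n) x v w : open U -> smooth_on U f -> U x ->
  'D_w (fun y => 'D_v f y) x = 'D_v (fun y => 'D_w f y) x.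
Proof.
move=> oU sf Ux; apply/rowP => i.
have coordD h h' :
    ('D_h (fun y => 'D_h' f y) x) 0 i = 'D_h (fun y => 'D_h' (fun z => f z 0 i) y) x.
  have dD := smooth_on_differentiable (smooth_on_derive h' sf) Ux.
  apply: (etrans (esym (derive_coordf h i dD))); apply: near_eq_derive; near=> y.
  have Uy : U y by near: y; exact: open_nbhs_nbhs.
  exact: (esym (derive_coordf h' i (smooth_on_differentiable sf Uy))).
apply: (etrans (coordD w v)); apply: (etrans _ (esym (coordD v w))).
exact: (derive_commute v w oU (smooth_on_coord i oU sf 2%N) Ux).
Unshelve. all: by end_near. Qed.

(** * Product rules for linear and bilinear maps depending on a point *)

Section ProductRules.
Context (R : realType) (V W : normedModType R) (n : nat).

(** Linearity in the second argument is only required near [u] because maps read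
    in a chart are linear only over the image of the chart. *)
Section Linear.
Context (A : V -> 'rV[R]_n -> W) (u : V).
Hypothesis Alin : \forall y \near u, linear (A y).
Hypothesis Adiff : forall v, differentiable (A ^~ v) u.

Let near_expand (Y : V -> 'rV[R]_n) : \near u,
  \sum_(i < n) Y u 0 i *: A u (delta_mx 0 i) = A u (Y u).
Proof. by near=> y; rewrite -rV_basis_expand//; near: y. Unshelve. all: by end_near. Qed.

Lemma derive_linear_arg v h : 'D_h (A ^~ v) u =
  \sum_(i < n) v 0 i *: 'D_h (A ^~ (delta_mx 0 i)) u.
Proof.
rewrite -(near_eq_derive _ (near_expand (fun=> v))).
have dA i : differentiable (fun y => v 0 i *: A y (delta_mx 0 i)) u.
  exact: (@differentiableZ _ _ _ (A ^~ (delta_mx 0 i))).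
rewrite (derive_sumf h dA); apply: eq_bigr => i _.
exact: (@deriveZ _ _ _ (A ^~ (delta_mx 0 i)) _ _ _ (diff_derivable (Adiff _))).
Qed.

Lemma differentiable_linear_apply (Y : V -> 'rV[R]_n) : differentiable Y u ->
  differentiable (fun y => A y (Y y)) u.
Proof.
move=> dY; apply: near_eq_differentiable (near_expand Y) _.
apply: differentiable_sumf => i.
apply: (@differentiable_scale _ _ _ (fun y => Y y 0 i) (A ^~ (delta_mx 0 i))) => //.
exact: differentiable_coordf.
Qed.

(** Expanding [Y y] on the basis reduces this to the product rule for scalings. *)
Lemma derive_linear_apply (Y : V -> 'rV[R]_n) h : differentiable Y u ->
  'D_h (fun y => A y (Y y)) u = 'D_h (A ^~ (Y u)) u + A u ('D_h Y u).
Proof.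
move=> dY; rewrite -(near_eq_derive _ (near_expand Y)).
have dYi i := differentiable_coordf i dY.
have dA i : differentiable (fun y => Y y 0 i *: A y (delta_mx 0 i)) u.
  exact: (@differentiable_scale _ _ _ (fun y => Y y 0 i) (A ^~ (delta_mx 0 i))).
rewrite (derive_sumf h dA) (derive_linear_arg (Y u) h).
rewrite (rV_basis_expand (nbhs_singleton Alin)) -big_split /=.
apply: eq_bigr => i _.
rewrite -(derive_coordf h i dY).
exact: (derive_scale h (dYi i) (Adiff (delta_mx 0 i))).
Qed.

End Linear.

Section Bilinear.
Context (B : V -> 'rV[R]_n -> 'rV[R]_n -> W) (u : V).
Hypothesis Bl : \forall y \near u, forall w, linear (fun v => B y v w).
Hypothesis Br : \forall y \near u, forall v, linear (B y v).
Hypothesis Bdiff : forall v w, differentiable (fun y => B y v w) u.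

Let near_linl w : \forall y \near u, linear (fun v => B y v w).
Proof. by near=> y; move: w; near: y. Unshelve. all: by end_near. Qed.

Let near_linr (Y : V -> 'rV[R]_n) : \forall y \near u, linear (B y (Y y)).
Proof. by near=> y; move: (Y y); near: y. Unshelve. all: by end_near. Qed.

Lemma derive_bilinear_apply (Y Z : V -> 'rV[R]_n) h :
  differentiable Y u -> differentiable Z u ->
  'D_h (fun y => B y (Y y) (Z y)) u = 'D_h (fun y => B y (Y u) (Z u)) u +
     B u ('D_h Y u) (Z u) + B u (Y u) ('D_h Z u).
Proof.
move=> dY dZ.
have dBY w : differentiable (fun y => B y (Y y) w) u.
  exact: (@differentiable_linear_apply (fun y v => B y v w) u).
rewrite (@derive_linear_apply (fun y => B y (Y y)) u (near_linr Y) dBY Z h dZ).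
by rewrite (@derive_linear_apply (fun y v => B y v (Z u)) u (near_linl (Z u))
  (fun v => Bdiff v (Z u)) Y h dY).
Qed.

End Bilinear.
End ProductRules.

Lemma linear_derive_arg (R : realType) (V W : normedModType R) (n : nat)
    (A : V -> 'rV[R]_n -> W) u h :
  (\forall y \near u, linear (A y)) -> (forall v, differentiable (A ^~ v) u) ->
  linear (fun v => 'D_h (A ^~ v) u).
Proof.
move=> Al Ad a v w.
rewrite (derive_linear_arg Al Ad v h) (derive_linear_arg Al Ad w h).
rewrite (derive_linear_arg Al Ad (a *: v + w) h) scaler_sumr -big_split /=.
by apply: eq_bigr => i _; rewrite !mxE scalerDl scalerA.
Qed.

Lemma smooth_linear_apply (R : realType) (V W : normedModType R) (n : nat)
    (U : set V) (A : V -> 'rV[R]_n -> W) (Y : V -> 'rV[R]_n) : open U ->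
  (forall y, U y -> linear (A y)) -> (forall v, smooth_on U (A ^~ v)) ->
  smooth_on U Y -> smooth_on U (fun y => A y (Y y)).
Proof.
move=> oU Al sA sY k.
have Ck : Ck_on k U (fun y => \sum_(i < n) Y y 0 i *: A y (delta_mx 0 i)).
  apply: Ck_on_sum => // i; apply: Ck_on_scale => //; last exact: sA.
  exact: smooth_on_coord.
by apply: Ck_on_eq Ck => // y Uy; rewrite -(rV_basis_expand (Al y Uy)).
Qed.

(** * Charts and tangent vectors *)

Section Charts.
Context (R : realType) (n : nat) (M : smoothManifold R n).
Implicit Types (c : chart R n M) (x : M) (W : set M) (v : 'rV[R]_n).

Lemma chart_at_atlas x : atlas (chart_at x).
Proof. by rewrite /chart_at; case: cid2. Qed.

Lemma chart_at_dom x : cdom (chart_at x) x.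
Proof. by rewrite /chart_at; case: cid2. Qed.

Lemma cmap_continuous_at c x : cdom c x -> {for x, continuous (cmap c)}.
Proof.
move=> cx; have := @cmap_continuous _ _ _ c.
rewrite (continuous_open_subspace _ (@cdom_open _ _ _ c)); apply.
exact: mem_set.
Qed.

Lemma cinv_continuous_at c x :
  cdom c x -> {for cmap c x, continuous (cinv c)}.
Proof.
move=> cx; have := @cinv_continuous _ _ _ c.
rewrite (continuous_open_subspace _ (@cimg_open _ _ _ c)); apply.
by apply: mem_set; exists x.
Qed.

Lemma open_chart_image c W : open W -> open (cmap c @` (cdom c `&` W)).
Proof.
move=> oW; rewrite openE => _ [x [cx Wx] <-]; rewrite /interior.
have nW : nbhs (cmap c x) (cinv c @^-1` W).
  apply: (cinv_continuous_at cx); rewrite cmapK//.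
  exact: open_nbhs_nbhs.
have nI : nbhs (cmap c x) (cmap c @` cdom c).
  by apply: open_nbhs_nbhs; split; [exact: cimg_open|exists x].
apply: filterS2 nW nI => u /= Wu [y cy yu].
by move: Wu; rewrite -yu cmapK// => Wy; exists y.
Qed.

Lemma near_chart_image c W x : open W -> cdom c x -> W x ->
  \forall u \near cmap c x, (cmap c @` (cdom c `&` W)) u.
Proof.
move=> oW cx Wx; apply: open_nbhs_nbhs; split; first exact: open_chart_image.
by exists x.
Qed.

Definition transition c c' : 'rV[R]_n -> 'rV[R]_n := cmap c' \o cinv c.

Lemma transition_cmap c c' x : cdom c x -> transition c c' (cmap c x) = cmap c' x.
Proof. by move=> cx; rewrite /transition /= cmapK. Qed.

Lemma smooth_transition c c' : atlas c -> atlas c' ->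
  smooth_on (cmap c @` (cdom c `&` cdom c')) (transition c c').
Proof. exact: atlas_compatible. Qed.

Lemma differentiable_transition c c' x : atlas c -> atlas c' -> cdom c x ->
  cdom c' x -> differentiable (transition c c') (cmap c x).
Proof.
move=> ac ac' cx cx'.
by apply: (smooth_on_differentiable (smooth_transition ac ac')); exists x.
Qed.

Lemma linear_coord_change c c' x : atlas c -> atlas c' -> cdom c x ->
  cdom c' x -> linear (coord_change c c' x).
Proof.
by move=> *; apply: derive_linear; exact: differentiable_transition.
Qed.

(** Functoriality of transition maps near the point, differentiated by the chain
    rule. *)
Lemma coord_change_comp c c' c'' x v :
  atlas c -> atlas c' -> atlas c'' -> cdom c x -> cdom c' x -> cdom c'' x ->
  coord_change c' c'' x (coord_change c c' x v) = coord_change c c'' x v.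
Proof.
move=> ac ac' ac'' cx cx' cx''; rewrite /coord_change -!/(transition _ _).
have dcc' := differentiable_transition ac ac' cx cx'.
have dcc'' : differentiable (transition c' c'') (transition c c' (cmap c x)).
  by rewrite transition_cmap//; exact: differentiable_transition.
have E := derive_comp v dcc' dcc''; rewrite (transition_cmap c' cx) in E.
apply: (etrans (esym E)); apply: near_eq_derive; near=> u.
have [y [cy cy'] <-] : (cmap c @` (cdom c `&` cdom c')) u.
  by near: u; apply: near_chart_image => //; exact: cdom_open.
by rewrite /= !transition_cmap.
Unshelve. all: by end_near. Qed.

Lemma coord_change_id c x v : cdom c x -> coord_change c c x v = v.
Proof.
move=> cx; rewrite /coord_change -/(transition _ _) -[RHS](derive_id (cmap c x)).
apply: near_eq_derive; near=> u.
have [y [cy _] <-] : (cmap c @` (cdom c `&` setT)) u.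
  by near: u; apply: near_chart_image => //; exact: openT.
by rewrite transition_cmap.
Unshelve. all: by end_near. Qed.

Section AtPoint.
Context (c : chart R n M) (x : M).
Hypotheses (ac : atlas c) (cx : cdom c x).

Lemma tangent_of_coordK v : coord_of_tangent c (tangent_of_coord c x v) = v.
Proof.
rewrite /coord_of_tangent /tangent_of_coord.
have [ax xx] := (chart_at_atlas x, chart_at_dom x).
by rewrite coord_change_comp// coord_change_id.
Qed.

Lemma coord_of_tangentK (v : tangent x) :
  tangent_of_coord c x (coord_of_tangent c v) = v.
Proof.
rewrite /coord_of_tangent /tangent_of_coord.
have [ax xx] := (chart_at_atlas x, chart_at_dom x).
by rewrite coord_change_comp// coord_change_id.
Qed.

Lemma linear_tangent_of_coord : linear (tangent_of_coord c x).
Proof.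
have [ax xx] := (chart_at_atlas x, chart_at_dom x).
exact: linear_coord_change.
Qed.

Lemma field_in_chart_cmap (X : forall x : M, tangent x) :
  field_in_chart c X (cmap c x) = coord_of_tangent c (X x).
Proof. by rewrite /field_in_chart cmapK. Qed.

End AtPoint.

Lemma field_in_chart_change c c' x (X : forall x : M, tangent x) :
  atlas c -> atlas c' -> cdom c x -> cdom c' x ->
  field_in_chart c' X (cmap c' x) =
  coord_change c c' x (field_in_chart c X (cmap c x)).
Proof.
move=> ac ac' cx cx'.
rewrite (field_in_chart_cmap cx' X) (field_in_chart_cmap cx X).
have [ax xx] := (chart_at_atlas x, chart_at_dom x).
by rewrite /coord_of_tangent coord_change_comp.
Qed.

End Charts.

(** * Constant fields and the metric in a chart *)

Definition metric_in_chart (R : realType) (n : nat) (M : smoothManifold R n)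
    (g : forall x : M, tangent x -> tangent x -> R) (c : chart R n M)
    (u v w : 'rV[R]_n) : R :=
  g (cinv c u) (tangent_of_coord c (cinv c u) v) (tangent_of_coord c (cinv c u) w).

Definition constant_field (R : realType) (n : nat) (M : smoothManifold R n)
    (c : chart R n M) (v : 'rV[R]_n) (x : M) : tangent x :=
  tangent_of_coord c x v.

Section ConstantFields.
Context (R : realType) (n : nat) (M : smoothManifold R n).
Context (c : chart R n M) (ac : atlas c) (v : 'rV[R]_n).

Lemma constant_field_in_chart c' x : atlas c' -> cdom c x -> cdom c' x ->
  field_in_chart c' (constant_field c v) (cmap c' x) = coord_change c c' x v.
Proof.
move=> ac' cx cx'; rewrite (field_in_chart_cmap cx' (constant_field c v)).
rewrite /constant_field /coord_of_tangent /tangent_of_coord.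
have [ax xx] := (chart_at_atlas x, chart_at_dom x).
by rewrite coord_change_comp.
Qed.

(** In a chart [c'] the components of this field are [D_v T] composed with the
    inverse transition, where [T] is the transition from [c] to [c']. *)
Lemma smooth_constant_field : smooth_field_on (cdom c) (constant_field c v).
Proof.
move=> c' ac'.
have oU : open (cmap c' @` (cdom c' `&` cdom c)).
  by apply: open_chart_image; exact: cdom_open.
have sD : smooth_on (cmap c' @` (cdom c' `&` cdom c))
    ((fun u => 'D_v (transition c c') u) \o transition c' c).
  apply: (@smooth_on_comp _ _ _ _ _ (cmap c @` (cdom c `&` cdom c'))) => //.
  - move=> _ [x [cx' cx] <-]; rewrite transition_cmap//.
    by exists x.
  - exact: smooth_transition.
  - by apply: smooth_on_derive; exact: smooth_transition.
apply: (smooth_on_eq oU _ sD) => _ [x [cx' cx] <-].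
rewrite (constant_field_in_chart ac' cx cx') /comp.
by rewrite (transition_cmap c cx').
Qed.

End ConstantFields.

Section MetricInChart.
Context (R : realType) (n : nat) (M : smoothManifold R n).
Context (g : forall x : M, tangent x -> tangent x -> R).
Hypothesis hg : riemannian_metric g.

Lemma metric_in_chart_cmap (c : chart R n M) x v w : cdom c x ->
  metric_in_chart g c (cmap c x) v w =
  g (tangent_of_coord c x v) (tangent_of_coord c x w).
Proof. by move=> cx; rewrite /metric_in_chart cmapK. Qed.

Lemma metric_in_chart_change (c c' : chart R n M) x v w :
  atlas c -> atlas c' -> cdom c x -> cdom c' x ->
  metric_in_chart g c (cmap c x) v w =
  metric_in_chart g c' (cmap c' x) (coord_change c c' x v) (coord_change c c' x w).
Proof.
move=> ac ac' cx cx'.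
rewrite (metric_in_chart_cmap v w cx) (metric_in_chart_cmap _ _ cx').
have [ax xx] := (chart_at_atlas x, chart_at_dom x).
rewrite /tangent_of_coord (coord_change_comp v ac ac' ax cx cx' xx).
by rewrite (coord_change_comp w ac ac' ax cx cx' xx).
Qed.

Section AtPoint.
Context (c : chart R n M) (x : M).
Hypotheses (ac : atlas c) (cx : cdom c x).

Lemma metric_coord (v w : tangent x) :
  g v w = metric_in_chart g c (cmap c x) (coord_of_tangent c v) (coord_of_tangent c w).
Proof.
rewrite (metric_in_chart_cmap _ _ cx).
by rewrite (coord_of_tangentK ac cx v) (coord_of_tangentK ac cx w).
Qed.

Lemma metric_in_chartC v w :
  metric_in_chart g c (cmap c x) v w = metric_in_chart g c (cmap c x) w v.
Proof. by case: hg => _ gC _ _; exact: gC. Qed.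

Lemma linear_metric_in_chartr v : linear (metric_in_chart g c (cmap c x) v).
Proof.
move=> a w w'; rewrite !metric_in_chart_cmap// linear_tangent_of_coord//.
by case: hg => gl _ _ _; rewrite gl.
Qed.

Lemma linear_metric_in_chartl w : linear (fun v => metric_in_chart g c (cmap c x) v w).
Proof.
by move=> a v v'; rewrite !(metric_in_chartC _ w) linear_metric_in_chartr.
Qed.

End AtPoint.

Section NearPoint.
Context (c : chart R n M) (x : M).
Hypotheses (ac : atlas c) (cx : cdom c x).

Lemma near_linear_metricr :
  \forall u \near cmap c x, forall v, linear (metric_in_chart g c u v).
Proof.
near=> u; have [y [cy _] <-] : (cmap c @` (cdom c `&` setT)) u.
  by near: u; apply: near_chart_image => //; exact: openT.
exact: linear_metric_in_chartr.
Unshelve. all: by end_near. Qed.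

Lemma near_linear_metricl :
  \forall u \near cmap c x, forall w, linear (fun v => metric_in_chart g c u v w).
Proof.
near=> u; have [y [cy _] <-] : (cmap c @` (cdom c `&` setT)) u.
  by near: u; apply: near_chart_image => //; exact: openT.
exact: linear_metric_in_chartl.
Unshelve. all: by end_near. Qed.

Lemma smooth_metric_in_chart v w :
  smooth_on (cmap c @` cdom c) (fun u => metric_in_chart g c u v w).
Proof. by case: hg => _ _ _; exact. Qed.

Lemma differentiable_metric v w :
  differentiable (fun u => metric_in_chart g c u v w) (cmap c x).
Proof.
by apply: (smooth_on_differentiable (smooth_metric_in_chart v w)); exists x.
Qed.

End NearPoint.
End MetricInChart.

(** * The Lie derivative in the chart at a point *)

(** For a coordinate field [Y] with constant components [v] in [c], the bracket
    [[X, Y]] has components [- D_v X], which explains the signs below. *)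
Definition lie_in_chart (R : realType) (n : nat) (M : smoothManifold R n)
    (X : forall x : M, tangent x) (g : forall x : M, tangent x -> tangent x -> R)
    (c : chart R n M) (u v w : 'rV[R]_n) : R :=
  'D_(field_in_chart c X u) (fun y => metric_in_chart g c y v w) u
  + metric_in_chart g c u ('D_v (field_in_chart c X) u) w
  + metric_in_chart g c u v ('D_w (field_in_chart c X) u).

Section Lie.
Context (R : realType) (n : nat) (M : smoothManifold R n).
Context (g : forall x : M, tangent x -> tangent x -> R).
Context (X : forall x : M, tangent x).
Hypotheses (hg : riemannian_metric g) (hX : smooth_field X).

Lemma smooth_field_in_chart (c : chart R n M) : atlas c ->
  smooth_on (cmap c @` cdom c) (field_in_chart c X).
Proof.
move=> ac; apply: smooth_on_sub (hX ac) => _ [x cx <-].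
by exists x.
Qed.

Lemma differentiable_field_on (W : set M) (Y : forall x : M, tangent x)
    (c : chart R n M) x :
  smooth_field_on W Y -> atlas c -> W x -> cdom c x ->
  differentiable (field_in_chart c Y) (cmap c x).
Proof.
move=> sY ac Wx cx.
by apply: (smooth_on_differentiable (sY c ac)); exists x.
Qed.

Lemma differentiable_field_in_chart (c : chart R n M) x :
  atlas c -> cdom c x -> differentiable (field_in_chart c X) (cmap c x).
Proof. by move=> ac cx; exact: (differentiable_field_on hX ac). Qed.

(** Tensoriality: the derivatives of the components of [Y] and [Z] produced by the
    product rule cancel those of the brackets. *)
Lemma lie_derivative_fieldsE (W : set M) (Y Z : forall x : M, tangent x) x :
  open W -> W x -> smooth_field_on W Y -> smooth_field_on W Z ->
  lie_derivative_fields X g Y Z x =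
  lie_in_chart X g (chart_at x) (cmap (chart_at x) x) (Y x) (Z x).
Proof.
move=> oW Wx sY sZ; set c := chart_at x.
have [ac cx] : atlas c /\ cdom c x by split; [exact: chart_at_atlas|exact: chart_at_dom].
(* Tangent vectors at [x] are their own coordinates in [chart_at x]. *)
have fieldx (F : forall x : M, tangent x) : field_in_chart c F (cmap c x) = F x.
  by rewrite (field_in_chart_cmap cx F); exact: coord_change_id.
have gx (v w : tangent x) : g v w = metric_in_chart g c (cmap c x) v w.
  apply: (etrans (metric_coord g ac cx v w)).
  by apply: f_equal2; exact: coord_change_id.
have dY := differentiable_field_on sY ac Wx cx.
have dZ := differentiable_field_on sZ ac Wx cx.
have gYZ : tangent_apply (X x) (fun y => g (Y y) (Z y)) =
    'D_(X x) (fun u => metric_in_chart g c u (field_in_chart c Y u)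
                         (field_in_chart c Z u)) (cmap c x).
  apply: near_eq_derive; near=> u.
  have [y [cy _] <-] : (cmap c @` (cdom c `&` setT)) u.
    by near: u; apply: near_chart_image => //; exact: openT.
  rewrite /comp -/c (cmapK cy) (metric_coord g ac cy).
  by rewrite (field_in_chart_cmap cy Y) (field_in_chart_cmap cy Z).
rewrite /lie_derivative_fields gYZ !gx.
rewrite (derive_bilinear_apply (near_linear_metricl hg ac cx)
  (near_linear_metricr hg ac cx) (differentiable_metric hg ac cx) (X x) dY dZ).
rewrite /lie_in_chart !fieldx /lie_bracket -/c.
have lr v := linear_metric_in_chartr hg ac cx v.
have ll w := linear_metric_in_chartl hg ac cx w.
have lB (F : 'rV[R]_n -> R) : linear F -> forall a b, F (a - b) = F a - F b.
  by move=> Fl a b; rewrite -[a - b]addrC -scaleN1r Fl scaleN1r addrC.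
rewrite (lB _ (lr (Y x))) (lB _ (ll (Z x))).
have cancel (a b d e f : R) : a + b + d - (b - e) - (d - f) = a + e + f by ring.
exact: cancel.
Unshelve. all: by end_near. Qed.

(** The set of candidate values is nonempty by tensoriality; its chosen element is
    identified by testing it on constant fields. *)
Lemma lie_derivativeE x (v w : tangent x) :
  lie_derivative X g v w =
  lie_in_chart X g (chart_at x) (cmap (chart_at x) x) v w.
Proof.
have [ac cx] := (chart_at_atlas x, chart_at_dom x).
have cfx (z : tangent x) : constant_field (chart_at x) z x = z.
  exact: coord_change_id.
rewrite /lie_derivative; set P := [set r | _].
have : P (xget 0 P).
  apply: xgetPex.
  exists (lie_in_chart X g (chart_at x) (cmap (chart_at x) x) v w).
  move=> W Y Z oW Wx sY sZ Yv Zw.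
  by rewrite (lie_derivative_fieldsE oW Wx sY sZ) Yv Zw.
move=> /(_ (cdom (chart_at x)) (constant_field (chart_at x) v)
  (constant_field (chart_at x) w) (@cdom_open _ _ _ _) cx
  (smooth_constant_field ac v) (smooth_constant_field ac w) (cfx v) (cfx w)) <-.
rewrite (lie_derivative_fieldsE (@cdom_open _ _ _ _) cx
  (smooth_constant_field ac v) (smooth_constant_field ac w)).
by rewrite (cfx v) (cfx w).
Qed.

End Lie.

(** * The Lie derivative in an arbitrary chart *)

Section ChartIndependence.
Context (R : realType) (n : nat) (M : smoothManifold R n).
Context (g : forall x : M, tangent x -> tangent x -> R).
Context (X : forall x : M, tangent x).
Hypotheses (hg : riemannian_metric g) (hX : smooth_field X).

Section TwoCharts.
Context (c c' : chart R n M) (x : M).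
Hypotheses (ac : atlas c) (ac' : atlas c') (cx : cdom c x) (cx' : cdom c' x).

Let T := transition c c'.
Let X_ := field_in_chart c X.
Let u := cmap c x.

Let oU : open (cmap c @` (cdom c `&` cdom c')).
Proof. by apply: open_chart_image; exact: cdom_open. Qed.

Let nearU : \forall y \near u, (cmap c @` (cdom c `&` cdom c')) y.
Proof. by apply: near_chart_image => //; exact: cdom_open. Qed.

Let sT : smooth_on (cmap c @` (cdom c `&` cdom c')) T.
Proof. exact: smooth_transition. Qed.

Let Ux : (cmap c @` (cdom c `&` cdom c')) u.
Proof. by exists x. Qed.

Let dT : differentiable T u.
Proof. exact: (smooth_on_differentiable sT Ux). Qed.

Let dDT v : differentiable (fun y => 'D_v T y) u.
Proof. exact: (smooth_on_differentiable (smooth_on_derive v sT) Ux). Qed.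

Let Tu : T u = cmap c' x.
Proof. exact: transition_cmap. Qed.

(** The field in [c'] is the differential of [T] applied to the field in [c]; its
    derivative picks up a second derivative of [T]. *)
Lemma derive_field_change v :
  'D_('D_v T u) (field_in_chart c' X) (cmap c' x) =
  'D_v (fun y => 'D_(X_ u) T y) u + 'D_('D_v X_ u) T u.
Proof.
have dX' : differentiable (field_in_chart c' X) (T u).
  by rewrite Tu; exact: differentiable_field_in_chart.
have dX : differentiable X_ u by exact: differentiable_field_in_chart.
have DTl : \forall y \near u, linear (fun w => 'D_w T y).
  near=> y; apply: derive_linear; apply: (smooth_on_differentiable sT).
  by near: y.
have E := derive_comp v dT dX'; rewrite Tu in E.
apply: (etrans (esym E)).
apply: (etrans _ (@derive_linear_apply _ _ _ _ (fun y w => 'D_w T y) u DTl dDT X_ v dX)).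
apply: near_eq_derive; near=> y.
have [z [cz cz'] <-] : (cmap c @` (cdom c `&` cdom c')) y by near: y.
rewrite /comp /T (transition_cmap c' cz).
exact: (field_in_chart_change X ac ac' cz cz').
Unshelve. all: by end_near. Qed.

(** The metric in [c] is the pullback by [T] of the metric in [c'], so its
    derivative along the field involves the second derivatives of [T] in the
    direction of the field and of each argument. *)
Lemma derive_metric_change v w :
  'D_(X_ u) (fun y => metric_in_chart g c y v w) u =
  'D_(field_in_chart c' X (cmap c' x))
      (fun y => metric_in_chart g c' y ('D_v T u) ('D_w T u)) (cmap c' x)
  + metric_in_chart g c' (cmap c' x) ('D_(X_ u) (fun y => 'D_v T y) u) ('D_w T u)
  + metric_in_chart g c' (cmap c' x) ('D_v T u) ('D_(X_ u) (fun y => 'D_w T y) u).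
Proof.
pose B y a b := metric_in_chart g c' (T y) a b.
have nT (P : 'rV[R]_n -> Prop) : 
    (\forall z \near cmap c' x, P z) -> \forall y \near u, P (T y).
  by rewrite -Tu => nP; apply: (differentiable_continuous dT).
have Bl := nT _ (near_linear_metricl hg ac' cx').
have Br := nT _ (near_linear_metricr hg ac' cx').
have dg a b : differentiable (fun y => metric_in_chart g c' y a b) (T u).
  by rewrite Tu; exact: differentiable_metric.
have dB a b : differentiable (fun y => B y a b) u.
  exact: (differentiable_comp dT (dg a b)).
have E := @derive_bilinear_apply _ _ _ _ B u Bl Br dB _ _ (X_ u) (dDT v) (dDT w).
have E1 := derive_comp (X_ u) dT (dg ('D_v T u) ('D_w T u)).
rewrite Tu in E1.
have Xu : 'D_(X_ u) T u = field_in_chart c' X (cmap c' x).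
  exact: (esym (field_in_chart_change X ac ac' cx cx')).
rewrite Xu in E1.
have E2 : 'D_(X_ u) (fun y => metric_in_chart g c y v w) u =
    'D_(X_ u) (fun y => B y ('D_v T y) ('D_w T y)) u.
  apply: near_eq_derive; near=> y.
  have [z [cz cz'] <-] : (cmap c @` (cdom c `&` cdom c')) y by near: y.
  rewrite /B /T (transition_cmap c' cz).
  exact: (metric_in_chart_change g v w ac ac' cz cz').
have Bu a b : B u a b = metric_in_chart g c' (cmap c' x) a b by rewrite /B Tu.
apply: (etrans E2); apply: (etrans E); rewrite !Bu.
exact: (f_equal (fun r => r + _ + _) E1).
Unshelve. all: by end_near. Qed.

(** The second derivatives of [T] in [derive_metric_change] and
    [derive_field_change] differ only by the order of differentiation. *)
Lemma lie_in_chart_change v w :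
  lie_in_chart X g c' (cmap c' x) (coord_change c c' x v) (coord_change c c' x w) =
  lie_in_chart X g c (cmap c x) v w.
Proof.
have lD (F : 'rV[R]_n -> R) : linear F -> forall a b, F (a + b) = F a + F b.
  by move=> Fl a b; rewrite -[a]scale1r Fl !scale1r.
have E z : 'D_('D_z T u) (field_in_chart c' X) (cmap c' x) =
    'D_(X_ u) (fun y => 'D_z T y) u + 'D_('D_z X_ u) T u.
  apply: (etrans (derive_field_change z)).
  by apply: (f_equal (+%R ^~ _)); exact: (derive_commute_rV _ _ oU sT Ux).
have El : metric_in_chart g c' (cmap c' x)
      ('D_('D_v T u) (field_in_chart c' X) (cmap c' x)) ('D_w T u) =
    metric_in_chart g c' (cmap c' x) ('D_(X_ u) (fun y => 'D_v T y) u) ('D_w T u)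
    + metric_in_chart g c u ('D_v X_ u) w.
  apply: (etrans (f_equal (fun a => metric_in_chart g c' _ a _) (E v))).
  apply: (etrans (lD _ (linear_metric_in_chartl hg ac' cx' _) _ _)).
  apply: (f_equal (fun r => _ + r)).
  exact: (esym (metric_in_chart_change g _ _ ac ac' cx cx')).
have Er : metric_in_chart g c' (cmap c' x) ('D_v T u)
      ('D_('D_w T u) (field_in_chart c' X) (cmap c' x)) =
    metric_in_chart g c' (cmap c' x) ('D_v T u) ('D_(X_ u) (fun y => 'D_w T y) u)
    + metric_in_chart g c u v ('D_w X_ u).
  apply: (etrans (f_equal (fun a => metric_in_chart g c' _ _ a) (E w))).
  apply: (etrans (lD _ (linear_metric_in_chartr hg ac' cx' _) _ _)).
  apply: (f_equal (fun r => _ + r)).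
  exact: (esym (metric_in_chart_change g _ _ ac ac' cx cx')).
have regroup (d d' a a' b b' e f : R) :
    d = d' + a + b -> a' = a + e -> b' = b + f -> d' + a' + b' = d + e + f.
  by move=> -> -> ->; ring.
exact: (regroup _ _ _ _ _ _ _ _ (derive_metric_change v w) El Er).
Qed.

End TwoCharts.

Lemma lie_derivative_in_chart (c : chart R n M) x (v w : tangent x) :
  atlas c -> cdom c x ->
  lie_derivative X g v w =
  lie_in_chart X g c (cmap c x) (coord_of_tangent c v) (coord_of_tangent c w).
Proof.
move=> ac cx; have [ax xx] := (chart_at_atlas x, chart_at_dom x).
rewrite (lie_derivativeE X hg v w).
exact: (esym (lie_in_chart_change ax ac xx cx v w)).
Qed.

End ChartIndependence.

(** * Families of quadratic forms *)

Section QuadraticForms.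
Context (R : realType) (n : nat).

Lemma compact_sphere : compact [set v : 'rV[R]_n | `|v| = 1].
Proof.
apply: bounded_closed_compact.
  exists 1; split; first exact: real1.
  by move=> r r1 v /= ->; exact: ltW.
apply: (@closed_comp _ _ (fun v : 'rV[R]_n => `|v|) [set 1]).
  by move=> v _; exact: norm_continuous.
exact: closed_eq.
Qed.

Definition bilinear_form (B : 'rV[R]_n -> 'rV[R]_n -> R) : Prop :=
  (forall v, linear (B v)) /\ (forall w, linear (fun v => B v w)).

Lemma bilinear_form_expand (B : 'rV[R]_n -> 'rV[R]_n -> R) v w :
  bilinear_form B -> B v w = \sum_(i < n) \sum_(j < n)
    v 0 i * w 0 j * B (delta_mx 0 i) (delta_mx 0 j).
Proof.
move=> [Br Bl]; apply: (etrans (rV_basis_expand (Bl w) v)).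
apply: eq_bigr => i _; rewrite (rV_basis_expand (Br _) w) scaler_sumr.
by apply: eq_bigr => j _; rewrite -mulrA.
Qed.

Lemma bilinear_form_scale (B : 'rV[R]_n -> 'rV[R]_n -> R) a v :
  bilinear_form B -> B (a *: v) (a *: v) = a ^+ 2 * B v v.
Proof.
move=> bB; rewrite !(bilinear_form_expand _ _ bB) mulr_sumr; apply: eq_bigr => i _.
rewrite mulr_sumr; apply: eq_bigr => j _; rewrite !mxE; ring.
Qed.

(** The function [h] below extends [L t v v + 2 s G t v v] from the points [t]
    where the forms are bilinear to a function that is continuous at every
    [(v, (t0, 0))].  It is negative on the product of the unit sphere with
    the point [(t0, 0)], hence on a neighbourhood of it by compactness of the
    sphere. *)
Lemma near_negative_form (T : topologicalType) (t0 : T)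
    (L G : T -> 'rV[R]_n -> 'rV[R]_n -> R) :
  (\forall t \near t0, bilinear_form (L t)) ->
  (\forall t \near t0, bilinear_form (G t)) ->
  (forall v w, {for t0, continuous (fun t => L t v w)}) ->
  (forall v w, {for t0, continuous (fun t => G t v w)}) ->
  (forall v, v != 0 -> L t0 v v < 0) ->
  \forall t \near t0 & s \near (0 : R), forall v,
    L t v v <= - (2 * s) * G t v v.
Proof.
move=> nL nG cL cG L0.
pose e i : 'rV[R]_n := delta_mx 0 i.
pose h (p : 'rV[R]_n * (T * R)) := \sum_(i < n) \sum_(j < n)
  p.1 0 i * p.1 0 j * (L p.2.1 (e i) (e j) + 2 * p.2.2 * G p.2.1 (e i) (e j)).
have hE v t s : bilinear_form (L t) -> bilinear_form (G t) ->
    h (v, (t, s)) = L t v v + 2 * s * G t v v.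
  move=> bL bG; rewrite (bilinear_form_expand v v bL) (bilinear_form_expand v v bG).
  rewrite mulr_sumr -big_split; apply: eq_bigr => i _ /=.
  by rewrite mulr_sumr -big_split; apply: eq_bigr => j _ /=; ring.
have ch v : {for (v, (t0, 0)), continuous h}.
  have c1 i : (fun p : 'rV[R]_n * (T * R) => p.1 0 i) @ (v, (t0, 0)) --> v 0 i.
    exact: (cvg_comp fst (fun w : 'rV[R]_n => w 0 i) cvg_fst
      (@coord_continuous _ _ _ 0 i v)).
  have c2 : (fun p : 'rV[R]_n * (T * R) => p.2.2) @ (v, (t0, 0)) --> (0 : R).
    exact: (cvg_comp snd snd cvg_snd cvg_snd).
  have c3 (H : T -> R) : {for t0, continuous H} ->
      (fun p : 'rV[R]_n * (T * R) => H p.2.1) @ (v, (t0, 0)) --> H t0.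
    move=> cH; apply: (cvg_comp (fst \o snd) H _ cH).
    exact: (cvg_comp snd fst cvg_snd cvg_fst).
  rewrite /prop_for /continuous_at /h.
  apply: cvg_big => [|i _]; first exact: add_continuous.
  apply: cvg_big => [|j _] /=; first exact: add_continuous.
  apply: cvgM; first by apply: cvgM; exact: c1.
  apply: cvgD; first exact: (c3 (fun t => L t (e i) (e j))).
  apply: cvgM; last exact: (c3 (fun t => G t (e i) (e j))).
  by apply: cvgM => //; exact: cvg_cst.
have [bL0 bG0] := (nbhs_singleton nL, nbhs_singleton nG).
have neg : \forall p \near filter_prod (nbhs t0) (nbhs (0 : R)),
    [set v : 'rV[R]_n | `|v| = 1] `<=` [set v | L p.1 v v + 2 * p.2 * G p.1 v v < 0].
  apply: (compact_near_coveringP _).1; first exact: compact_sphere.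
  move=> v /= v1.
  have hv : h (v, (t0, 0)) < 0.
    rewrite hE// mulr0 mul0r addr0; apply: L0.
    by rewrite -normr_eq0 v1 oner_neq0.
  have nh : \forall p \near (v, (t0, 0 : R)), h p < 0.
    have nlt : nbhs (h (v, (t0, 0))) [set r | r < 0] by exact: lt_nbhsl.
    exact: (ch v _ nlt).
  have nb : \forall p \near (v, (t0, 0 : R)),
      bilinear_form (L p.2.1) /\ bilinear_form (G p.2.1).
    have cT : (fun p : 'rV[R]_n * (T * R) => p.2.1) @ (v, (t0, 0)) --> t0.
      exact: (cvg_comp snd fst cvg_snd cvg_fst).
    by apply: filterI; [exact: (cT _ nL)|exact: (cT _ nG)].
  apply: filterS2 nh nb => -[v' [t s]] /= + [bL bG].
  by rewrite hE.
have bLG : \forall p \near filter_prod (nbhs t0) (nbhs (0 : R)),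
    bilinear_form (L p.1) /\ bilinear_form (G p.1).
  have cT : fst @ filter_prod (nbhs t0) (nbhs (0 : R)) --> t0 by exact: cvg_fst.
  by apply: filterI; [exact: (cT _ nL)|exact: (cT _ nG)].
apply: filterS2 neg bLG => -[t s] /= neg [bL bG] v.
rewrite mulNr -subr_le0 opprK.
have [->|v0] := eqVneq v 0.
  rewrite -(scale0r (0 : 'rV[R]_n)) !bilinear_form_scale//.
  by rewrite expr0n /= !mul0r mulr0 addr0.
have vE : v = `|v| *: (`|v|^-1 *: v).
  by rewrite scalerA mulfV ?normr_eq0// scale1r.
have /neg /= : [set w : 'rV[R]_n | `|w| = 1] (`|v|^-1 *: v).
  by rewrite /= normrZ normfV normr_id mulVf// normr_eq0.
rewrite vE !(bilinear_form_scale `|v|)// -vE => neg1.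
set w := _^-1 *: v in neg1 *.
rewrite mulrCA -mulrDr; apply: mulr_ge0_le0; first exact: sqr_ge0.
exact: ltW.
Qed.
End QuadraticForms.

(** * Contraction near a point and on a compact set *)

Section LieForm.
Context (R : realType) (n : nat) (M : smoothManifold R n).
Context (g : forall x : M, tangent x -> tangent x -> R).
Context (X : forall x : M, tangent x).
Hypotheses (hg : riemannian_metric g) (hX : smooth_field X).
Context (c : chart R n M) (ac : atlas c).

Lemma bilinear_metric_in_chart x : cdom c x ->
  bilinear_form (metric_in_chart g c (cmap c x)).
Proof.
by move=> cx; split;
  [exact: (linear_metric_in_chartr hg)|exact: (linear_metric_in_chartl hg)].
Qed.

Lemma bilinear_lie_in_chart x : cdom c x ->
  bilinear_form (lie_in_chart X g c (cmap c x)).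
Proof.
move=> cx; have [gr gl] := bilinear_metric_in_chart cx.
have DX : linear (fun v => 'D_v (field_in_chart c X) (cmap c x)).
  exact: derive_linear (differentiable_field_in_chart hX ac cx).
have addL (F1 F2 F3 : 'rV[R]_n -> R) : linear F1 -> linear F2 -> linear F3 ->
    linear (fun v => F1 v + F2 v + F3 v).
  move=> l1 l2 l3 a v w; rewrite l1 l2 l3 !scalerDr (addrACA (a *: F1 v)).
  by rewrite (addrACA (a *: F1 v + _)).
have compL (F : 'rV[R]_n -> R) (D : 'rV[R]_n -> 'rV[R]_n) : linear F -> linear D ->
    linear (fun v => F (D v)).
  by move=> Fl Dl a v w; rewrite Dl Fl.
split=> [v|w]; apply: addL.
- apply: (@linear_derive_arg _ _ _ _ (fun y => metric_in_chart g c y v)).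
    by near=> y; move: v; near: y; exact: near_linear_metricr.
  by move=> w; exact: differentiable_metric.
- exact: gr.
- exact: (compL _ _ (gr v) DX).
- apply: (@linear_derive_arg _ _ _ _ (fun y v => metric_in_chart g c y v w)).
    by near=> y; move: w; near: y; exact: near_linear_metricl.
  by move=> v; exact: differentiable_metric.
- exact: (compL _ _ (gl w) DX).
- exact: gl.
Unshelve. all: by end_near. Qed.

Lemma smooth_lie_in_chart v w :
  smooth_on (cmap c @` cdom c) (fun u => lie_in_chart X g c u v w).
Proof.
have oU := @cimg_open _ _ _ c.
have sX := smooth_field_in_chart hX ac.
have sg a b := smooth_metric_in_chart hg ac a b.
have sD : smooth_on (cmap c @` cdom c) (fun u =>
    'D_(field_in_chart c X u) (fun y => metric_in_chart g c y v w) u).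
  apply: (@smooth_linear_apply _ _ _ _ _
    (fun u a => 'D_a (fun y => metric_in_chart g c y v w) u) _ oU _ _ sX).
    by move=> _ [x cx <-]; apply: derive_linear; exact: differentiable_metric.
  by move=> a; exact: smooth_on_derive (sg v w).
have sl : smooth_on (cmap c @` cdom c) (fun u =>
    metric_in_chart g c u ('D_v (field_in_chart c X) u) w).
  apply: (@smooth_linear_apply _ _ _ _ _ (fun u a => metric_in_chart g c u a w) _
    oU _ (fun a => sg a w) (smooth_on_derive v sX)).
  by move=> _ [x cx <-]; exact: (bilinear_metric_in_chart cx).2.
have sr : smooth_on (cmap c @` cdom c) (fun u =>
    metric_in_chart g c u v ('D_w (field_in_chart c X) u)).
  apply: (@smooth_linear_apply _ _ _ _ _ (fun u a => metric_in_chart g c u v a) _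
    oU _ (fun a => sg v a) (smooth_on_derive w sX)).
  by move=> _ [x cx <-]; exact: (bilinear_metric_in_chart cx).1.
by move=> k; exact: (Ck_on_add oU (Ck_on_add oU (sD k) (sl k)) (sr k)).
Qed.

(** All points near [x] are treated in the one chart [c], where the coefficients of
    the Lie derivative and of the metric are continuous. *)
Lemma near_contracting x : cdom c x ->
  (forall v : tangent x, v != 0 -> lie_derivative X g v v < 0) ->
  \forall y \near x & s \near (0 : R), forall v : tangent y,
    lie_derivative X g v v <= - (2 * s) * g v v.
Proof.
move=> cx neg.
have ncdom : \forall y \near x, cdom c y.
  by apply: open_nbhs_nbhs; split => //; exact: cdom_open.
have ccomp (h : 'rV[R]_n -> R) : smooth_on (cmap c @` cdom c) h ->
    {for x, continuous (h \o cmap c)}.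
  move=> sh; apply: continuous_comp; first exact: cmap_continuous_at.
  by apply: (smooth_on_continuous sh); exists x.
have : \forall y \near x & s \near (0 : R), forall v : 'rV[R]_n,
    lie_in_chart X g c (cmap c y) v v <=
    - (2 * s) * metric_in_chart g c (cmap c y) v v.
  apply: (@near_negative_form _ _ _ x (fun y => lie_in_chart X g c (cmap c y))
    (fun y => metric_in_chart g c (cmap c y))).
  - by apply: filterS ncdom => y; exact: bilinear_lie_in_chart.
  - by apply: filterS ncdom => y; exact: bilinear_metric_in_chart.
  - by move=> v w; exact: (ccomp (fun u => lie_in_chart X g c u v w)
      (smooth_lie_in_chart v w)).
  - by move=> v w; exact: (ccomp (fun u => metric_in_chart g c u v w)
      (smooth_metric_in_chart hg ac v w)).
  - move=> v v0.
    have tv : tangent_of_coord c x v != 0.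
      apply: contra v0 => /eqP tv0; rewrite -(tangent_of_coordK ac cx v) tv0.
      have [ax xx] := (chart_at_atlas x, chart_at_dom x).
      by rewrite /coord_of_tangent /coord_change derive0.
    have := neg _ tv.
    rewrite (lie_derivative_in_chart hg hX _ _ ac cx).
    by rewrite (tangent_of_coordK ac cx v).
have ncd2 : \forall y \near x & s \near (0 : R), cdom c y.
  exact: (cvg_fst ncdom).
apply: filterS2 ncd2 => -[y s] /= cy + v => /(_ (coord_of_tangent c v)).
rewrite (lie_derivative_in_chart hg hX _ _ ac cy).
by rewrite (metric_coord g ac cy).
Qed.

End LieForm.

Theorem theorem2 (R : realType) (n : nat) (M : smoothManifold R n)
    (g : forall x : M, tangent x -> tangent x -> R)
    (X : forall x : M, tangent x) (Utilde : set M)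
    (hg : riemannian_metric g) (hX : smooth_field X)
    (hUtilde : compact Utilde)
    (hneg : negative_definite_on (lie_derivative X g) Utilde) :
  forall U : set M, open U -> U `<=` Utilde -> contracting_system X g U.
Proof.
move=> U oU UUt; split => //.
(* A compact set satisfies a property for all [s] near 0 as soon as each of its
   points has a neighbourhood where it holds for all [s] near 0. *)
pose P (s : R) (x : M) := forall v : tangent x,
  lie_derivative X g v v <= - (2 * s) * g x v v.
have rates : \forall s \near nbhs (0 : R), Utilde `<=` P s.
  have /compact_near_coveringP cover := hUtilde.
  apply: (cover R (nbhs (0 : R)) P) => x Ux.
  by apply: (near_contracting hg hX (chart_at_atlas x) (chart_at_dom x)); exact: hneg.
have [e /= e0 rate] := (nbhs_ballP _ _).1 rates.
have e20 : 0 < e / 2 by rewrite divr_gt0.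
(* Any positive number in the ball of radius [e] around 0 would do. *)
exists (e / 2); split => // x Ux.
apply: (rate _ _ x (UUt _ Ux)).
rewrite -ball_normE /ball_ /= sub0r normrN gtr0_norm//.
by rewrite ltr_pdivrMr// ltr_pMr// ltr1n.
Qed.
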